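(* Let $k>0$, $\chi>0$, let $I_H$ be a linear operator from a real vector space $V$ of velocity fields into itself, let $u^{n+1}=u(t^{n+1})\in V$ and $\widetilde v^{n+1}\in V$, and let $v^{n+1}\in V$ satisfy Step 2A, i.e. $$\frac{v^{n+1}-\widetilde v^{n+1}}{k}-\chi I_H\big(u^{n+1}-v^{n+1}\big)=0 .$$ Then $$v^{n+1}=\widetilde v^{n+1}+\frac{k\chi}{1+k\chi}I_H\big(u^{n+1}-\widetilde v^{n+1}\big)+\frac{(k\chi)^2}{1+k\chi}\big[I_H-I_H^2\big]\big(u^{n+1}-v^{n+1}\big).$$ Consequently, if $I_H^2=I_H$, then $$v^{n+1}=\widetilde v^{n+1}+\frac{k\chi}{1+k\chi}I_H\big(u^{n+1}-\widetilde v^{n+1}\big).$$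
   Context: $k$ is the time step, $\chi$ the nudging parameter, $u$ the true velocity being observed, $\widetilde v^{n+1}$ the forecast (output of Step 1 of a two-step data assimilation method), $v^{n+1}$ the analysis (output of Step 2A), and $I_H$ the linear observation operator (interpolation, restriction, projection or averaging associated with observation spacing $H$). $I_H^2=I_H\circ I_H$. *)

(* Defs.v *)
From HB Require Import structures.
From mathcomp Require Import all_boot all_order all_algebra.
From mathcomp Require Import reals.
Set Implicit Arguments.
Unset Strict Implicit.
Unset Printing Implicit Defensive.
Import Order.TTheory GRing.Theory Num.Theory.
Local Open Scope ring_scope.

(* [vt] is the forecast, [v] the analysis, [u] the observed velocity, all at
   the same time level. *)
Definition step2A (R : realType) (V : lmodType R) (k chi : R)
    (IH : {linear V -> V}) (u vt v : V) : Prop :=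
  k^-1 *: (v - vt) - chi *: IH (u - v) = 0.

(* Main.v *)
Require Import Defs.
From HB Require Import structures.
From mathcomp Require Import all_boot all_order all_algebra.
From mathcomp Require Import reals.
From mathcomp Require Import ring.
Set Implicit Arguments.
Unset Strict Implicit.
Unset Printing Implicit Defensive.
Import Order.TTheory GRing.Theory Num.Theory.
Local Open Scope ring_scope.

(** With [c = k * chi] and [e = u - v], Step 2A says that the increment [v - vt] is [c *: IH e].
    Adding [e] and applying [IH] gives [IH (u - vt) = IH e + c *: IH (IH e)]. In the claimed formula
    the double observations then cancel, and the coefficients of [IH e] sum to [c], which is the
    increment again. *)

Lemma step2A_increment (R : realType) (V : lmodType R) (k chi : R)
    (IH : {linear V -> V}) (u vt v : V) :
  k != 0 -> step2A k chi IH u vt v -> v - vt = (k * chi) *: IH (u - v).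
Proof.
move=> k_neq0 /eqP; rewrite subr_eq0 => /eqP /(congr1 ( *:%R k)).
by rewrite !scalerA divff // scale1r.
Qed.

Theorem proposition2p1 (R : realType) (V : lmodType R) (k chi : R)
    (k_gt0 : 0 < k) (chi_gt0 : 0 < chi) (IH : {linear V -> V})
    (u : R -> V) (t : nat -> R) (n : nat) (vt v : nat -> V)
    (analysis : step2A k chi IH (u (t n.+1)) (vt n.+1) (v n.+1)) :
  v n.+1 = vt n.+1
           + (k * chi / (1 + k * chi)) *: IH (u (t n.+1) - vt n.+1)
           + ((k * chi) ^+ 2 / (1 + k * chi))
               *: (IH \- (IH \o IH)) (u (t n.+1) - v n.+1)
  /\
  (IH \o IH =1 IH ->
   v n.+1 = vt n.+1
            + (k * chi / (1 + k * chi)) *: IH (u (t n.+1) - vt n.+1)).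
Proof.
have := step2A_increment (lt0r_neq0 k_gt0) analysis.
move: (u _) (vt _) (v _) (mulr_gt0 k_gt0 chi_gt0) => {analysis}u {}vt {}v.
move: (k * chi) => c c_gt0 incr.
have c1_neq0 : 1 + c != 0 by rewrite lt0r_neq0 // addr_gt0.
(* Linearity of [IH] on the splitting [u - vt = (u - v) + (v - vt)]. *)
have innov : IH (u - vt) = IH (u - v) + c *: IH (IH (u - v)).
  by rewrite -linearZ -incr -linearD addrA subrK.
have expand : v = vt + (c / (1 + c)) *: IH (u - vt)
    + (c ^+ 2 / (1 + c)) *: (IH \- (IH \o IH)) (u - v).
  rewrite innov /= -addrA -[LHS](subrKC vt) incr; congr (_ + _).
  rewrite scalerDr scalerBr scalerA addrACA -scalerDl.
  (* The terms in [IH (IH (u - v))] carry opposite coefficients, both [c ^+ 2 / (1 + c)] up to sign;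
     what remains is [c = c / (1 + c) + c ^+ 2 / (1 + c)]. *)
  rewrite (mulrAC c (1 + c)^-1) -expr2 subrr addr0.
  by congr (_ *: _); field.
split=> // idem.
(* Simplification unfolds the composition; it is folded back so that the pointwise equality [idem]
   can rewrite it. *)
by rewrite {1}expand /= -[IH (IH _)]/((IH \o IH) _) idem subrr scaler0 addr0.
Qed.
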